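(* Let $\mathbf{h},\mathbf{g}\in\mathbb{R}^{S\times K}_*$ be such that $\|P(\mathbf{g})-P(\mathbf{h})\|_\infty\leq\frac12\max\left(\|P(\mathbf{h})\|_\infty,\|P(\mathbf{g})\|_\infty\right)$. Then for all $p,q\in[1,\infty]$, $$d_p(\langle\mathbf{h}\rangle,\langle\mathbf{g}\rangle)\leq 7\,(KS)^{\frac1p}\,\min\left(\|P(\mathbf{h})\|_\infty^{\frac1K-1},\|P(\mathbf{g})\|_\infty^{\frac1K-1}\right)\|P(\mathbf{h})-P(\mathbf{g})\|_q .$$
   Context: Let $K\geq 1$ and $S\geq 2$ be integers, $[K]=\{1,\dots,K\}$, $[S]=\{1,\dots,S\}$. An element $\mathbf{h}\in\mathbb{R}^{S\times K}$ is a $K$-tuple of vectors $\mathbf{h}_1,\dots,\mathbf{h}_K\in\mathbb{R}^S$; the $i$-th entry of $\mathbf{h}_k$ is $\mathbf{h}_{k,i}$. $\mathbb{R}^{S^K}$ is the space of real order-$K$ tensors $T=(T_{\mathbf{i}})_{\mathbf{i}\in[S]^K}$. $\|\cdot\|_p$ is the usual entrywise $\ell^p$ norm on $\mathbb{R}^{S\times K}$ and on $\mathbb{R}^{S^K}$ (max of absolute values if $p=\infty$); $1/\infty=0$. The Segre embedding is $P:\mathbb{R}^{S\times K}\to\mathbb{R}^{S^K}$, $P(\mathbf{h})_{\mathbf{i}}=\mathbf{h}_{1,i_1}\mathbf{h}_{2,i_2}\cdots\mathbf{h}_{K,i_K}$ for $\mathbf{i}=(i_1,\dots,i_K)\in[S]^K$.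 Set $\mathbb{R}^{S\times K}_*=\{\mathbf{h}\in\mathbb{R}^{S\times K} : \mathbf{h}_k\neq 0 \ \forall k\in[K]\}$. On $\mathbb{R}^{S\times K}_*$ define the equivalence relation: $\mathbf{h}\sim\mathbf{g}$ iff there exist $\lambda_1,\dots,\lambda_K\in\mathbb{R}$ with $\prod_{k=1}^K\lambda_k=1$ and $\mathbf{h}_k=\lambda_k\mathbf{g}_k$ for all $k\in[K]$. The class of $\mathbf{h}$ is denoted $\langle\mathbf{h}\rangle$. Set $\mathbb{R}^{S\times K}_{\rm diag}=\{\mathbf{h}\in\mathbb{R}^{S\times K}_* : \|\mathbf{h}_k\|_\infty=\|\mathbf{h}_1\|_\infty\ \forall k\in[K]\}$. For $p\in[1,\infty]$ and $\mathbf{h},\mathbf{g}\in\mathbb{R}^{S\times K}_*$, $$d_p(\langle\mathbf{h}\rangle,\langle\mathbf{g}\rangle)=\inf\{\|\mathbf{h}'-\mathbf{g}'\|_p : \mathbf{h}'\in\langle\mathbf{h}\rangle\cap\mathbb{R}^{S\times K}_{\rm diag},\ \mathbf{g}'\in\langle\mathbf{g}\rangle\cap\mathbb{R}^{S\times K}_{\rm diag}\}.$$ *)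

(* Defs.v *)
From mathcomp Require Import all_boot all_order all_algebra.
From mathcomp Require Import all_classical all_reals all_analysis.

Set Implicit Arguments.
Unset Strict Implicit.
Unset Printing Implicit Defensive.

Import Order.TTheory GRing.Theory Num.Theory.

Local Open Scope classical_set_scope.
Local Open Scope ring_scope.

(* Meant for p in [1, +oo] only; the value at p = -oo is irrelevant. *)
Definition lpnorm (R : realType) (I : finType) (p : \bar R) (x : I -> R) : R :=
  match p with
  | r%:E => (\sum_(i : I) `|x i| `^ r) `^ r^-1
  | _ => \big[Num.max/0]_(i : I) `|x i|
  end.

Definition mxlpnorm (R : realType) (m n : nat) (p : \bar R)
    (A : 'M[R]_(m, n)) : R :=
  lpnorm p (fun ij : 'I_m * 'I_n => A ij.1 ij.2).

Definition tensor (R : realType) (S K : nat) := {ffun {ffun 'I_K -> 'I_S} -> R}.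

(* An element h of R^{S x K} is an S x K matrix: the vector h_k is the column
   [col k h], and its i-th entry h_{k,i} is [h i k]. *)
Definition segre (R : realType) (S K : nat) (h : 'M[R]_(S, K)) :
    tensor R S K :=
  [ffun i : {ffun 'I_K -> 'I_S} => \prod_(k < K) h (i k) k].

Definition star (R : realType) (S K : nat) : set 'M[R]_(S, K) :=
  [set h | forall k : 'I_K, col k h != 0].

Definition scale_equiv (R : realType) (S K : nat) (h g : 'M[R]_(S, K)) : Prop :=
  exists lam : 'I_K -> R,
    \prod_(k < K) lam k = 1 /\ forall k : 'I_K, col k h = lam k *: col k g.

Definition scale_class (R : realType) (S K : nat) (h : 'M[R]_(S, K)) :
    set 'M[R]_(S, K) :=
  [set h' | star h' /\ scale_equiv h' h].

(* [k1] is the first index; it is quantified so that K can be any natural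
   number, including those not syntactically of the form [n.+1]. *)
Definition diag (R : realType) (S K : nat) : set 'M[R]_(S, K) :=
  [set h | star h /\
    forall k1 : 'I_K, k1 = 0%N :> nat -> forall k : 'I_K,
      mxlpnorm +oo%E (col k h) = mxlpnorm +oo%E (col k1 h)].

(* Distance between classes A and B, as sets of representatives.  For classes of
   elements of [star], the set below is nonempty and bounded below by 0, so
   [inf] is a genuine infimum. *)
Definition dclass (R : realType) (S K : nat) (p : \bar R)
    (A B : set 'M[R]_(S, K)) : R :=
  inf [set mxlpnorm p (h' - g') |
        h' in A `&` @diag R S K & g' in B `&` @diag R S K].

(* Main.v *)
Require Import Defs.
From mathcomp Require Import all_boot all_order all_algebra.
From mathcomp Require Import all_classical all_reals all_analysis.
From mathcomp Require Import ring lra.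

Set Implicit Arguments.
Unset Strict Implicit.
Unset Printing Implicit Defensive.

Import Order.TTheory GRing.Theory Num.Theory.

Local Open Scope ring_scope.

(** Let [A >= B] be the max norms of [P(h)] and [P(g)], and [D] that of their
    difference.  Choose [i_k] maximizing [|h_{k,i}|].  As [D < A], the entries
    of [P(h)] and [P(g)] at [i] have the same sign, so both classes contain a
    balanced representative such that the [i_k]-th entries of the [k]-th
    vectors have equal signs for every [k].  Write these representatives as
    [A^(1/K) u] and [B^(1/K) v] with [u_k], [v_k] of max norm 1.  Comparing
    [P(h)] and [P(g)] at [i] with the single coordinate [i_k] replaced by [j]
    gives [|A u_{k,j} - M v_{k,j}| <= D] for some [M] with
    [A - D <= M <= B <= A], and multiplying by [A^(1/K - 1)] bounds the
    distance of the representatives by [2 A^(1/K - 1) D]. *)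

(** * Comparison of the entrywise norms *)

Section LpNorm.
Context {R : realType} {I : finType}.
Implicit Types (p : \bar R) (x : I -> R).

Lemma lpnormy_ler x i : `|x i| <= lpnorm +oo%E x.
Proof. exact: (le_bigmax 0 (fun i => `|x i|)). Qed.

Lemma lpnormy_leP x c : 0 <= c ->
  (forall i, `|x i| <= c) -> lpnorm +oo%E x <= c.
Proof. by move=> c0 xc; apply/bigmax_leP; split. Qed.

Lemma lpnormy_ge0 x : 0 <= lpnorm +oo%E x.
Proof. exact: bigmax_ge_id. Qed.

Lemma lpnorm_ge0 p x : 0 <= lpnorm p x.
Proof. by case: p => [r| |]; [exact: powR_ge0|exact: lpnormy_ge0..]. Qed.

Lemma lpnormy_attained x (i0 : I) : exists i, `|x i| = lpnorm +oo%E x.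
Proof.
have [i _ xi] := @eq_bigmax _ _ I 0 i0 predT (fun i => `|x i|) isT
  (fun i _ => normr_ge0 (x i)).
by exists i; rewrite -xi.
Qed.

Lemma eq_lpnorm p x y : (forall i, `|x i| = `|y i|) -> lpnorm p x = lpnorm p y.
Proof.
move=> xy; case: p => [r| |] /=; [|exact: eq_bigr..].
by congr powR; apply: eq_bigr => i _; rewrite xy.
Qed.

Lemma lpnormyZ (c : R) x : lpnorm +oo%E (fun i => c * x i) = `|c| * lpnorm +oo%E x.
Proof.
rewrite /lpnorm; elim/big_rec2: _ => [|i a b _ ->]; first by rewrite mulr0.
by rewrite normrM maxr_pMr.
Qed.

Lemma lpnormy_le_lpnorm p x : (1 <= p)%E -> lpnorm +oo%E x <= lpnorm p x.
Proof.
case: p => [r| |] //; rewrite lee_fin => r1.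
have r0 : 0 < r by exact: lt_le_trans r1.
apply: lpnormy_leP => [|i]; first exact: powR_ge0.
rewrite -[leLHS](powRr1 (normr_ge0 _)) -(divff (lt0r_neq0 r0)) powRrM.
have sum0 (P : pred I) : 0 <= \sum_(k | P k) `|x k| `^ r.
  by apply: sumr_ge0 => k _; exact: powR_ge0.
apply: ge0_ler_powR; rewrite ?nnegrE ?powR_ge0 ?invr_ge0 ?(ltW r0)//.
by rewrite (bigD1 i)//= lerDl.
Qed.

Lemma lpnorm_le_lpnormy p x : (1 <= p)%E ->
  lpnorm p x <= #|I|%:R `^ fine (p^-1)%E * lpnorm +oo%E x.
Proof.
case: p => [r| |] //; last first.
  (* For [p = +oo] the inverse is 0, so the cardinality factor is 1. *)
  by move=> _; rewrite invey /= powRr0 mul1r.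
rewrite lee_fin fine_invr => r1.
have r0 : 0 < r by exact: lt_le_trans r1.
set M := lpnorm +oo%E x.
have M0 : 0 <= M by exact: lpnormy_ge0.
have -> : #|I|%:R `^ r^-1 * M = (#|I|%:R * M `^ r) `^ r^-1.
  by rewrite powRM ?powR_ge0 // -powRrM divff ?lt0r_neq0// powRr1.
apply: ge0_ler_powR; rewrite ?nnegrE ?invr_ge0 ?(ltW r0)//.
- by apply: sumr_ge0 => k _; exact: powR_ge0.
- by rewrite mulr_ge0 ?powR_ge0.
rewrite mulr_natl -sumr_const; apply: ler_sum => i _.
by apply: ge0_ler_powR; rewrite ?nnegrE ?(ltW r0)//; exact: lpnormy_ler.
Qed.

End LpNorm.

Lemma le0_ger_powR {R : realType} (r a b : R) : r <= 0 -> 0 < b -> b <= a ->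
  a `^ r <= b `^ r.
Proof.
move=> r0 b0 ba; have a0 := lt_le_trans b0 ba.
rewrite -(opprK r) !(powRN _ (- r)) lef_pV2 ?posrE ?powR_gt0//.
by apply: ge0_ler_powR; rewrite ?nnegrE ?oppr_ge0 ?(ltW a0) ?(ltW b0).
Qed.

(** * Segre embedding and rescaling of columns *)

Section Segre.
Context {R : realType} {S K : nat}.
Implicit Types (h g : 'M[R]_(S, K)) (lam : 'I_K -> R).

Lemma col_ler h j k : `|h j k| <= mxlpnorm +oo%E (col k h).
Proof.
have := lpnormy_ler (fun ij : 'I_S * 'I_1 => col k h ij.1 ij.2) (j, ord0).
by rewrite /= mxE.
Qed.

Lemma col_attained h : star h -> exists i : {ffun 'I_K -> 'I_S},
  forall k, `|h (i k) k| = mxlpnorm +oo%E (col k h).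
Proof.
move=> hs.
have ex k : exists j, `|h j k| = mxlpnorm +oo%E (col k h).
  (* A nonzero column guarantees a row index; a maximum over no rows would be the default 0,
     attained nowhere. *)
  have /cV0Pn[j0 _] := hs k.
  have [[j l] /=] := lpnormy_attained
    (fun ij : 'I_S * 'I_1 => col k h ij.1 ij.2) (j0, ord0).
  by rewrite mxE => hj; exists j.
by have [i iP] := choice ex; exists (finfun i) => k; rewrite ffunE.
Qed.

Lemma col_gt0 h k : star h -> 0 < mxlpnorm +oo%E (col k h).
Proof.
move=> /(_ k) /cV0Pn[j]; rewrite mxE => hj.
by apply: lt_le_trans (col_ler h j k); rewrite normr_gt0.
Qed.

(** The factors of an entry of [segre h] depend on separate indices, so maximizing every column
    independently maximizes the product. *)
Lemma segre_lpnormy h : star h ->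
  lpnorm +oo%E (segre h) = \prod_(k < K) mxlpnorm +oo%E (col k h).
Proof.
move=> hs; apply/eqP; rewrite eq_le; apply/andP; split.
  apply: lpnormy_leP => [|i].
    by apply: prodr_ge0 => k _; exact: ltW (col_gt0 k hs).
  rewrite ffunE normr_prod; apply: ler_prod => k _.
  by rewrite normr_ge0 col_ler.
have [i iP] := col_attained hs.
have := lpnormy_ler (segre h) i; rewrite ffunE normr_prod.
by under eq_bigr do rewrite iP.
Qed.

Lemma segre_update h (i : {ffun 'I_K -> 'I_S}) k j :
  segre h [ffun l => if l == k then j else i l] =
  h j k * \prod_(l < K | l != k) h (i l) l.
Proof.
rewrite ffunE (bigD1 k)//= ffunE eqxx; congr (_ * _).
by apply: eq_bigr => l /negPf lk; rewrite ffunE lk.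
Qed.

Definition col_scale lam h : 'M[R]_(S, K) := \matrix_(j, k) (lam k * h j k).

Lemma col_col_scale lam h k : col k (col_scale lam h) = lam k *: col k h.
Proof. by apply/matrixP => j l; rewrite !mxE. Qed.

Lemma col_scale_class lam h : star h -> \prod_(k < K) lam k = 1 ->
  scale_class h (col_scale lam h).
Proof.
move=> hs lam1; split; last by exists lam; split=> // k; exact: col_col_scale.
move=> k; rewrite col_col_scale scaler_eq0 negb_or (hs k) andbT.
apply/eqP => lk0; move: lam1; rewrite (bigD1 k)//= lk0 mul0r => /esym /eqP.
by rewrite oner_eq0.
Qed.

Lemma mxlpnorm_col_scale lam h k :
  mxlpnorm +oo%E (col k (col_scale lam h)) = `|lam k| * mxlpnorm +oo%E (col k h).
Proof.
by rewrite col_col_scale /mxlpnorm -lpnormyZ; apply: eq_lpnorm => ij; rewrite !mxE.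
Qed.

Lemma col_scale_diag lam h (a : R) : star h -> \prod_(k < K) lam k = 1 ->
  (forall k, `|lam k| * mxlpnorm +oo%E (col k h) = a) ->
  diag (col_scale lam h).
Proof.
move=> hs lam1 lama; split; first by have [] := col_scale_class hs lam1.
by move=> k1 _ k; rewrite !mxlpnorm_col_scale !lama.
Qed.

End Segre.

Lemma sgr_eq_of_dist {R : realType} (x y : R) : `|y - x| < `|x| -> Num.sg y = Num.sg x.
Proof.
have [x0|x0|->] := ltrgt0P x; last by rewrite ltNge normr_ge0.
  rewrite ltr_norml => /andP[yx _]; rewrite !gtr0_sg//; lra.
rewrite ltr_norml => /andP[_ yx]; rewrite !ltr0_sg//; lra.
Qed.

(** * Balanced representatives with matching signs *)

Section Balanced.
Context {R : realType} {S K : nat}.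
Implicit Types (h g : 'M[R]_(S, K)).

(** Brings column [k] to max norm the [K]-th root of that of [segre h]. When [x k] is an entry of
    that column, its rescaled value gets the sign of [t k]. *)
Definition balancing (t x : 'I_K -> R) h (k : 'I_K) : R :=
  t k * Num.sg (x k) * lpnorm +oo%E (segre h) `^ K%:R^-1 / mxlpnorm +oo%E (col k h).

Lemma segre_lpnormy_gt0 h : star h -> 0 < lpnorm +oo%E (segre h).
Proof.
by move=> hs; rewrite segre_lpnormy//; apply: prodr_gt0 => k _; exact: col_gt0.
Qed.

(** The [K] roots multiply to the norm of [segre h], which is the product of the column norms; the
    signs multiply to a square. *)
Lemma prod_balancing t x h : (0 < K)%N -> star h ->
  \prod_(k < K) t k = Num.sg (\prod_(k < K) x k) -> \prod_(k < K) x k != 0 ->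
  \prod_(k < K) balancing t x h k = 1.
Proof.
move=> K0 hs tx x0; rewrite /balancing !big_split/= tx prodfV -segre_lpnormy//.
rewrite -(big_morph Num.sg (@sgrM R) (@sgr1 R)) -expr2 sqr_sg x0 mul1r.
rewrite prodr_const card_ord -powR_mulrn ?powR_ge0// -powRrM mulVf ?pnatr_eq0 -?lt0n//.
by rewrite powRr1 ?divff ?gt_eqF ?segre_lpnormy_gt0// ltW// segre_lpnormy_gt0.
Qed.

Lemma norm_balancing t x h k : star h -> `|t k| = 1 -> x k != 0 ->
  `|balancing t x h k| * mxlpnorm +oo%E (col k h) =
  lpnorm +oo%E (segre h) `^ K%:R^-1.
Proof.
move=> hs tk xk; have ck := col_gt0 k hs.
rewrite /balancing !normrM tk mul1r normr_sg xk mul1r normfV (ger0_norm (powR_ge0 _ _)).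
by rewrite (gtr0_norm ck) divfK ?gt_eqF.
Qed.

(* Here [u], [v] are corresponding entries of the normalized vectors, and [M]
   is the max norm of [P(g)] with one index free and the others fixed. *)
Lemma balanced_entry (A B D M u v a b w : R) :
  0 <= w -> `|v| <= 1 -> a = w * A -> w * B <= b -> b <= a ->
  A - D <= M -> M <= B -> `|A * u - M * v| <= D ->
  `|a * u - b * v| <= 2 * w * D.
Proof.
move=> w0 v1 aE wB ba DM MB AM.
(* Each term contributes [w * D]: the second because [0 <= b - w * M <= a - w * (A - D) = w * D]. *)
have -> : a * u - b * v = w * (A * u - M * v) - (b - w * M) * v by rewrite aE; ring.
apply: le_trans (ler_normB _ _) _; rewrite !normrM (ger0_norm w0).
have wM : 0 <= b - w * M by rewrite subr_ge0 (le_trans _ wB)// ler_wpM2l.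
rewrite (ger0_norm wM).
have h1 : w * `|A * u - M * v| <= w * D by exact: ler_wpM2l.
have h2 : (b - w * M) * `|v| <= b - w * M by exact: ler_piMr.
have h3 : w * (A - D) <= w * M by exact: ler_wpM2l.
rewrite aE in ba; lra.
Qed.

Lemma balanced_close h g : (0 < K)%N -> star h -> star g ->
  lpnorm +oo%E (segre g) <= lpnorm +oo%E (segre h) ->
  lpnorm +oo%E (segre g - segre h) < lpnorm +oo%E (segre h) ->
  exists h' g', [/\ scale_class h h', diag h', scale_class g g', diag g' &
    mxlpnorm +oo%E (h' - g') <=
    2 * lpnorm +oo%E (segre h) `^ (K%:R^-1 - 1) * lpnorm +oo%E (segre g - segre h)].
Proof.
move=> K0 hs gs; have [i iP] := col_attained hs.
have A0 := segre_lpnormy_gt0 hs; have B0 := segre_lpnormy_gt0 gs.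
set A := lpnorm _ (segre h) in A0 *; set B := lpnorm _ (segre g) in B0 *.
set D := lpnorm _ (segre g - segre h) => BA DA.
pose x k := h (i k) k; pose y k := g (i k) k.
have XE : segre h i = \prod_(k < K) x k by rewrite ffunE.
have YE : segre g i = \prod_(k < K) y k by rewrite ffunE.
have D_ge i' : `|segre g i' - segre h i'| <= D.
  by have := lpnormy_ler (segre g - segre h) i'; rewrite !ffunE.
have XA : `|segre h i| = A.
  by rewrite XE normr_prod /A segre_lpnormy//; apply: eq_bigr => k _; exact: iP.
have sYX : Num.sg (segre g i) = Num.sg (segre h i).
  by apply: sgr_eq_of_dist; rewrite XA (le_lt_trans (D_ge i)).
have X0 : segre h i != 0 by rewrite -normr_gt0 XA.
have Y0 : segre g i != 0 by rewrite -sgr_eq0 sYX sgr_eq0.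
have x0 k : x k != 0 by move: X0; rewrite XE => /prodf_neq0 /(_ k isT).
have y0 k : y k != 0 by move: Y0; rewrite YE => /prodf_neq0 /(_ k isT).
pose s := Num.sg (segre h i).
(* The common sign [s] of the two tensors at [i] is put on the first column. Both representatives
   use the same [t], so it factors out of their difference. *)
pose t (k : 'I_K) := if k == Ordinal K0 then s else 1.
have t1 k : `|t k| = 1.
  by rewrite /t; case: ifP => _; rewrite ?normr1// normr_sg X0.
have ts : \prod_(k < K) t k = s.
  by rewrite (bigD1 (Ordinal K0))//= big1 /t ?eqxx ?mulr1// => k /negPf ->.
have lam1 : \prod_(k < K) balancing t x h k = 1.
  by apply: prod_balancing; rewrite -?XE.
have mu1 : \prod_(k < K) balancing t y g k = 1.
  by apply: prod_balancing; rewrite -?YE ?sYX.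
exists (col_scale (balancing t x h) h), (col_scale (balancing t y g) g).
split; [exact: col_scale_class| |exact: col_scale_class| |].
- by apply: col_scale_diag lam1 _ => // k; exact: norm_balancing.
- by apply: col_scale_diag mu1 _ => // k; exact: norm_balancing.
apply: lpnormy_leP => [|[j k]]; first by rewrite !mulr_ge0 ?powR_ge0 ?lpnormy_ge0.
rewrite !mxE /= /balancing -/A -/B.
set c := mxlpnorm _ _; set d := mxlpnorm _ (col k g).
set a := A `^ _; set b := B `^ _.
have c0 : 0 < c by exact: col_gt0.
have d0 : 0 < d by exact: col_gt0.
pose u := Num.sg (x k) * h j k / c; pose v := Num.sg (y k) * g j k / d.
pose C := \prod_(l < K | l != k) x l; pose E := \prod_(l < K | l != k) y l.
have XC : segre h i = x k * C by rewrite XE (bigD1 k).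
have YEk : segre g i = y k * E by rewrite YE (bigD1 k).
have -> : t k * Num.sg (x k) * a / c * h j k - t k * Num.sg (y k) * b / d * g j k
   = t k * (a * u - b * v) by rewrite /u /v; ring.
rewrite normrM t1 mul1r.
(* Up to the sign [s], [A * u] is the entry of [segre h] at [i] with coordinate [k] replaced by [j];
   [BE] is the analogue for [g], with [M = |E| * d]. *)
have AE : A * u = s * (h j k * C).
  have -> : A = `|C| * c by rewrite -XA XC normrM mulrC {1}/x iP.
  by rewrite /u /s XC sgrM normrEsg; field; exact: lt0r_neq0.
have BE : `|E| * d * v = s * (g j k * E).
  by rewrite /v /s -sYX YEk sgrM normrEsg; field; exact: lt0r_neq0.
apply: (@balanced_entry A B D (`|E| * d) u v) => //.
- exact: powR_ge0.
- rewrite /v normrM normfV (gtr0_norm d0) ler_pdivrMr// mul1r normrM normr_sg y0 mul1r.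
  exact: col_ler.
- by rewrite mulrC mulr_powRB1// ?invr_gt0 ?ltr0n// ltW.
(* With [w] the power of [A] of exponent [1/K - 1 <= 0], [B <= A] makes [w] at most the same power
   of [B]. *)
- rewrite /b -(@mulr_powRB1 _ B) ?invr_gt0 ?ltr0n ?(ltW B0)// mulrC.
  apply: ler_wpM2l; first exact: ltW.
  by apply: le0_ger_powR => //; rewrite subr_le0 invf_le1 ?ltr0n// ler1n.
- by apply: ge0_ler_powR; rewrite ?nnegrE ?invr_ge0 ?ler0n ?(ltW A0) ?(ltW B0).
(* The entry at [i] is one of those over which [M] is the maximum. *)
- have le1 : A - D <= `|segre g i|.
    have := D_ge i; have := lerB_dist (segre h i) (segre g i).
    rewrite distrC XA; lra.
  apply: le_trans le1 _; rewrite YEk normrM mulrC.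
  by apply: ler_wpM2l => //; exact: col_ler.
- rewrite /B segre_lpnormy// (bigD1 k)//= -/d mulrC.
  apply: ler_wpM2l; first exact: ltW.
  rewrite normr_prod; apply: ler_prod => l _; rewrite normr_ge0/=; exact: col_ler.
have := D_ge [ffun l => if l == k then j else i l].
by rewrite !segre_update AE BE -mulrBr normrM normr_sg X0 mul1r distrC.
Qed.

End Balanced.

(** * Bounding the distance between classes *)

Lemma dclass_le {R : realType} {S K : nat} (p : \bar R) (h' g' : 'M[R]_(S, K)) A B :
  A h' -> diag h' -> B g' -> diag g' -> dclass p A B <= mxlpnorm p (h' - g').
Proof.
move=> Ah' dh' Bg' dg'; apply: ge_inf; last by exists h' => //; exists g'.
by exists 0 => _ [? _ [? _ <-]]; exact: lpnorm_ge0.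
Qed.

Theorem theorem4p3 (R : realType) (K S : nat) (hK : (1 <= K)%N) (hS : (2 <= S)%N)
    (h g : 'M[R]_(S, K)) (hstar : star h) (gstar : star g)
    (hclose : lpnorm +oo%E (segre g - segre h) <=
      2^-1 * Num.max (lpnorm +oo%E (segre h)) (lpnorm +oo%E (segre g)))
    (p q : \bar R) (hp : (1 <= p)%E) (hq : (1 <= q)%E) :
  dclass p (scale_class h) (scale_class g) <=
    7 * (K * S)%:R `^ fine (p^-1)%E *
      Num.min (lpnorm +oo%E (segre h) `^ (K%:R^-1 - 1))
              (lpnorm +oo%E (segre g) `^ (K%:R^-1 - 1)) *
      lpnorm q (segre h - segre g).
Proof.
have A0 := segre_lpnormy_gt0 hstar; have B0 := segre_lpnormy_gt0 gstar.
have Dsym : lpnorm +oo%E (segre h - segre g) = lpnorm +oo%E (segre g - segre h).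
  by apply: eq_lpnorm => i; rewrite !ffunE distrC.
set A := lpnorm _ (segre h) in hclose A0 *; set B := lpnorm _ (segre g) in hclose B0 *.
have r0 : K%:R^-1 - 1 <= 0 :> R by rewrite subr_le0 invf_le1 ?ltr0n// ler1n.
(* A max-norm bound with constant 2 suffices: the [p]-norm on the left costs the power of [K * S],
   the [q]-norm on the right costs nothing, and [2 <= 7]. *)
suff [h' [g' [hh' dh' gg' dg' close]]] : exists h' g',
    [/\ scale_class h h', diag h', scale_class g g', diag g' &
    mxlpnorm +oo%E (h' - g') <=
    2 * Num.min (A `^ (K%:R^-1 - 1)) (B `^ (K%:R^-1 - 1)) *
    lpnorm +oo%E (segre h - segre g)].
  apply: le_trans (dclass_le p hh' dh' gg' dg') _.
  apply: le_trans (lpnorm_le_lpnormy _ hp) _.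
  rewrite card_prod !card_ord mulnC -(mulrA 7) mulrCA -!mulrA.
  apply: ler_wpM2l; first exact: powR_ge0.
  apply: le_trans close _; rewrite -!mulrA; apply: ler_pM => //.
  - by rewrite mulr_ge0 ?lpnormy_ge0// le_min !powR_ge0.
  - by rewrite ler_nat.
  apply: ler_wpM2l; first by rewrite le_min !powR_ge0.
  exact: lpnormy_le_lpnorm.
(* The exponent is nonpositive, so the minimum belongs to the larger norm. Half of that positive
   norm is strictly below it, which gives the strict closeness [balanced_close] asks for. *)
have [BA|/ltW AB] := leP B A.
  rewrite min_l ?le0_ger_powR// Dsym; apply: balanced_close => //.
  by apply: le_lt_trans hclose _; rewrite max_l// -/A; lra.
rewrite min_r ?le0_ger_powR//.
have [||g' [h' [gg' dg' hh' dh' close]]] := balanced_close hK gstar hstar.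
- exact: AB.
- by rewrite Dsym; apply: le_lt_trans hclose _; rewrite max_r// -/B; lra.
exists h', g'; split=> //; rewrite (_ : mxlpnorm _ _ = mxlpnorm +oo%E (g' - h'))//.
by apply: eq_lpnorm => ij; rewrite !mxE distrC.
Qed.
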